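(* A discrete Demoulin surface admits four discrete envelopes of the associated lattice of Lie quadrics which coincide.
   Context: For a function $h$ on $\mathbb{Z}^2$, $h_1(n_1,n_2)=h(n_1+1,n_2)$, $h_2(n_1,n_2)=h(n_1,n_2+1)$, $h_{\bar1},h_{\bar2}$ are the inverse shifts and $\Delta_ih=h_i-h$. Superscripts in $r^1,r^2,r^{12}$ are labels, not shifts, and bars on letters such as $\bar a$ merely distinguish functions. A discrete asymptotic net $\Sigma$ is a discrete surface in the real projective space $\mathbb{P}^3$ with homogeneous coordinates $r:\mathbb{Z}^2\to\mathbb{R}^4$ such that the points $r,r_1,r_2,r_{\bar1},r_{\bar2}$ of any star are coplanar; the quadrilaterals $[r,r_1,r_2,r_{12}]$ of $\Sigma$ are assumed non-planar. A quadric is associated with a quadrilateral if it passes through its four extended edges. A lattice of Lie quadrics $\{Q\}$ is a set of quadrics associated with the quadrilaterals of $\Sigma$ (one for each quadrilateral) such that the tangent planes of any two neighbouring quadrics coincide at each point of the common edge. Adapted canonical frame: homogeneous coordinates $r$ and functions $\alpha,\bar\alpha$ with $\alpha\bar\alpha_1=\bar\alpha\alpha_2$ are chosen such that, with $r^1=\alpha r_1$, $r^2=\bar\alpha r_2$, $r^{12}=\alpha\bar\alpha_1r_{12}$, the quadrics of the lattice are $Q=r^{12}+\mu r^1+\nu r^2+\mu\nu r$ ($\mu,\nu$ parametrising the generators) and $$r_1=\tfrac1\alpha r^1,\quad r^1_1=-\alpha r+u r^1+b r^{12},\quad r^2_1=\tfrac1\alpha r^{12},\quad r^{12}_1=a r^1-\alpha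 r^2+v r^{12},$$ $$r_2=\tfrac1{\bar\alpha} r^2,\quad r^1_2=\tfrac1{\bar\alpha} r^{12},\quad r^2_2=-\bar\alpha r+\bar u r^2+\bar b r^{12},\quad r^{12}_2=-\bar\alpha r^1+\bar a r^2+\bar v r^{12}$$ (here $r^1_1=(r^1)_1$, etc.). Put $g=(u-v)/2$, $\bar g=(\bar u-\bar v)/2$, $T=ab+g^2$, $\bar T=\bar a\bar b+\bar g^2$. It is assumed that no three consecutive vertices of any coordinate polygon are collinear, equivalently that $a,b,\bar a,\bar b$ do not vanish. The net $\Sigma$ is a discrete projective minimal surface if there exists a lattice of Lie quadrics such that, in terms of the adapted canonical frame, $\Delta_2T=0$ or, equivalently, $\Delta_1\bar T=0$; this lattice is the associated lattice of Lie quadrics. A discrete Demoulin surface is a discrete projective minimal surface with $T=\bar T=0$. An envelope $\Omega$ of $\{Q\}$ is a combinatorially dual discrete asymptotic net (its vertices correspond to the quadrilaterals of $\Sigma$), represented by a map $\omega:\mathbb{Z}^2\to\mathbb{R}^4$, such that the star of $\Omega$ centred at any vertex $\omega$ touches the corresponding quadric $Q$ at $\omega\in Q$. Envelopes are said to coincide if they are the same when regarded as sets of points in $\mathbb{P}^3$ (their parametrisations may differ by shifts on the lattice). *)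

(* Defs.v *)
From mathcomp Require Import all_boot all_order all_algebra.
Set Implicit Arguments.
Unset Strict Implicit.
Unset Printing Implicit Defensive.
Import Order.TTheory GRing.Theory Num.Theory.
Local Open Scope ring_scope.

Definition lattice (T : Type) := int -> int -> T.

Definition sh1 (T : Type) (h : lattice T) : lattice T := fun i j => h (i + 1) j.
Definition sh2 (T : Type) (h : lattice T) : lattice T := fun i j => h i (j + 1).
Definition sh1V (T : Type) (h : lattice T) : lattice T := fun i j => h (i - 1) j.
Definition sh2V (T : Type) (h : lattice T) : lattice T := fun i j => h i (j - 1).
Definition sh12 (T : Type) (h : lattice T) : lattice T := sh1 (sh2 h).

Definition delta2 (R : zmodType) (h : lattice R) : lattice R :=
  fun i j => sh2 h i j - h i j.

(* Points of P^3 are given by nonzero row vectors of homogeneous coordinates. *)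
Definition same_point (R : fieldType) (x y : 'rV[R]_4) : Prop :=
  exists2 c : R, c != 0 & x = c *: y.

Definition coplanar (R : fieldType) (s : seq 'rV[R]_4) : bool :=
  (\dim <<s>>%VS <= 3)%N.
Definition collinear (R : fieldType) (s : seq 'rV[R]_4) : bool :=
  (\dim <<s>>%VS <= 2)%N.

Definition star (R : fieldType) (w : lattice 'rV[R]_4) (i j : int) :=
  [:: w i j; sh1 w i j; sh2 w i j; sh1V w i j; sh2V w i j].

Definition quadrilateral (R : fieldType) (w : lattice 'rV[R]_4) (i j : int) :=
  [:: w i j; sh1 w i j; sh2 w i j; sh12 w i j].

Definition asymptotic_net (R : fieldType) (w : lattice 'rV[R]_4) : Prop :=
  (forall i j, w i j != 0) /\ (forall i j, coplanar (star w i j)).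

(* The standing assumptions on the surface Sigma (they are not part of the
   notion of asymptotic net, and are not imposed on its envelopes). *)
Definition generic_net (R : fieldType) (w : lattice 'rV[R]_4) : Prop :=
  [/\ forall i j, ~~ coplanar (quadrilateral w i j),
      forall i j, ~~ collinear [:: w i j; sh1 w i j; sh1 (sh1 w) i j]
    & forall i j, ~~ collinear [:: w i j; sh2 w i j; sh2 (sh2 w) i j]].

(* A quadric is given by its matrix.  It is taken to be non-degenerate, so that
   it has a tangent plane at each of its points; this is automatic for quadrics
   parametrised as in [adapted_frame] below. *)
Definition is_quadric (R : fieldType) (A : 'M[R]_4) : Prop :=
  A^T = A /\ A \in unitmx.

Definition polar (R : fieldType) (A : 'M[R]_4) (x y : 'rV[R]_4) : R :=
  (x *m A *m y^T) 0 0.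

Definition on_quadric (R : fieldType) (A : 'M[R]_4) (x : 'rV[R]_4) : Prop :=
  polar A x x = 0.

(* [in_tangent_plane A x y]: the point y lies in the tangent plane at x. *)
Definition in_tangent_plane (R : fieldType) (A : 'M[R]_4) (x y : 'rV[R]_4) :
  Prop := polar A x y = 0.

Definition quadric_contains_line (R : fieldType) (A : 'M[R]_4)
    (p q : 'rV[R]_4) : Prop :=
  forall x, x \in <<[:: p; q]>>%VS -> on_quadric A x.

Definition same_tangent_planes_along (R : fieldType) (A B : 'M[R]_4)
    (p q : 'rV[R]_4) : Prop :=
  forall x, x \in <<[:: p; q]>>%VS -> x != 0 ->
  forall y, in_tangent_plane A x y <-> in_tangent_plane B x y.

(* Q i j is associated with the quadrilateral [r, r_1, r_2, r_12] at (i, j). *)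
Definition lattice_of_Lie_quadrics (R : fieldType) (S : lattice 'rV[R]_4)
    (Q : lattice 'M[R]_4) : Prop :=
  [/\ forall i j, is_quadric (Q i j),
      forall i j,
        [/\ quadric_contains_line (Q i j) (S i j) (sh1 S i j),
            quadric_contains_line (Q i j) (S i j) (sh2 S i j),
            quadric_contains_line (Q i j) (sh1 S i j) (sh12 S i j)
          & quadric_contains_line (Q i j) (sh2 S i j) (sh12 S i j)],
      forall i j, same_tangent_planes_along (Q i j) (sh1 Q i j)
                    (sh1 S i j) (sh12 S i j)
    & forall i j, same_tangent_planes_along (Q i j) (sh2 Q i j)
                    (sh2 S i j) (sh12 S i j)].

(* Data of an adapted canonical frame; the prefix b stands for a bar. *)
Record frame (R : fieldType) := Frame {
  fr : lattice 'rV[R]_4;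
  alpha : lattice R;
  balpha : lattice R;
  fu : lattice R; fv : lattice R; fa : lattice R; fb : lattice R;
  bu : lattice R; bv : lattice R; ba : lattice R; bb : lattice R
}.

Definition fr1 (R : fieldType) (F : frame R) : lattice 'rV[R]_4 :=
  fun i j => alpha F i j *: sh1 (fr F) i j.
Definition fr2 (R : fieldType) (F : frame R) : lattice 'rV[R]_4 :=
  fun i j => balpha F i j *: sh2 (fr F) i j.
Definition fr12 (R : fieldType) (F : frame R) : lattice 'rV[R]_4 :=
  fun i j => (alpha F i j * sh1 (balpha F) i j) *: sh12 (fr F) i j.

Definition frame_equations1 (R : fieldType) (F : frame R) (i j : int) : Prop :=
  let: (r, r1, r2, r12) := (fr F i j, fr1 F i j, fr2 F i j, fr12 F i j) in
  let al := alpha F i j in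
  [/\ sh1 (fr F) i j = al^-1 *: r1,
      sh1 (fr1 F) i j = - al *: r + fu F i j *: r1 + fb F i j *: r12,
      sh1 (fr2 F) i j = al^-1 *: r12
    & sh1 (fr12 F) i j = fa F i j *: r1 - al *: r2 + fv F i j *: r12].

Definition frame_equations2 (R : fieldType) (F : frame R) (i j : int) : Prop :=
  let: (r, r1, r2, r12) := (fr F i j, fr1 F i j, fr2 F i j, fr12 F i j) in
  let bal := balpha F i j in
  [/\ sh2 (fr F) i j = bal^-1 *: r2,
      sh2 (fr1 F) i j = bal^-1 *: r12,
      sh2 (fr2 F) i j = - bal *: r + bu F i j *: r2 + bb F i j *: r12
    & sh2 (fr12 F) i j = - bal *: r1 + ba F i j *: r2 + bv F i j *: r12].

(* The quadric r^12 + mu r^1 + nu r^2 + mu nu r, with the generator parameters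
   mu = m/s and nu = n/t ranging over the projective line. *)
Definition adapted_frame (R : fieldType) (S : lattice 'rV[R]_4)
    (Q : lattice 'M[R]_4) (F : frame R) : Prop :=
  (forall i j, same_point (fr F i j) (S i j)) /\
  (forall i j,
    [/\ alpha F i j != 0, balpha F i j != 0
      & alpha F i j * sh1 (balpha F) i j = balpha F i j * sh2 (alpha F) i j]) /\
  (forall i j x, on_quadric (Q i j) x <->
    exists s m t n : R,
      x = (s * t) *: fr12 F i j + (m * t) *: fr1 F i j
          + (s * n) *: fr2 F i j + (m * n) *: fr F i j) /\
  (forall i j, frame_equations1 F i j /\ frame_equations2 F i j).

Definition fg (R : fieldType) (F : frame R) : lattice R :=
  fun i j => (fu F i j - fv F i j) / 2%:R.
Definition bg (R : fieldType) (F : frame R) : lattice R :=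
  fun i j => (bu F i j - bv F i j) / 2%:R.
Definition fT (R : fieldType) (F : frame R) : lattice R :=
  fun i j => fa F i j * fb F i j + fg F i j ^+ 2.
Definition bT (R : fieldType) (F : frame R) : lattice R :=
  fun i j => ba F i j * bb F i j + bg F i j ^+ 2.

(* S is discrete projective minimal, Q is its associated lattice of Lie
   quadrics and F is the adapted canonical frame. *)
Definition projective_minimal (R : fieldType) (S : lattice 'rV[R]_4)
    (Q : lattice 'M[R]_4) (F : frame R) : Prop :=
  [/\ asymptotic_net S, generic_net S, lattice_of_Lie_quadrics S Q,
      adapted_frame S Q F & forall i j, delta2 (fT F) i j = 0].

Definition demoulin (R : fieldType) (S : lattice 'rV[R]_4)
    (Q : lattice 'M[R]_4) (F : frame R) : Prop :=
  [/\ projective_minimal S Q F,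
      forall i j, fT F i j = 0 & forall i j, bT F i j = 0].

Definition envelope (R : fieldType) (Q : lattice 'M[R]_4)
    (w : lattice 'rV[R]_4) : Prop :=
  [/\ asymptotic_net w,
      forall i j, on_quadric (Q i j) (w i j)
    & forall i j x, x \in star w i j -> in_tangent_plane (Q i j) (w i j) x].

(* Each vertex of a quadrilateral of S lies on the associated Lie quadric, which
   touches the star of S there.  Hence S itself, with its vertices attached to
   the quadrilaterals in any of the four possible ways, satisfies [envelope].
   The following predicate excludes this trivial solution. *)
Definition distinct_from_net (R : fieldType) (S w : lattice 'rV[R]_4) : Prop :=
  forall i j x, x \in quadrilateral S i j -> ~ same_point (w i j) x.

Definition coincide (R : fieldType) (w w' : lattice 'rV[R]_4) : Prop :=
  forall x, (exists i j, same_point x (w i j)) <->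
            (exists i j, same_point x (w' i j)).

Definition same_parametrised_net (R : fieldType) (w w' : lattice 'rV[R]_4) :
  Prop := forall i j, same_point (w i j) (w' i j).

(* Main.v *)
Require Import Defs.
From mathcomp Require Import all_boot all_order all_algebra.
From mathcomp Require Import ring.
Set Implicit Arguments.
Unset Strict Implicit.
Unset Printing Implicit Defensive.
Import Order.TTheory GRing.Theory Num.Theory.
Local Open Scope ring_scope.

(** Write Q_1, Q_2, Q_12 for the Lie quadrics of the neighbouring
quadrilaterals, and use the parameters (mu, nu) of the point
r12 + mu r1 + nu r2 + mu nu r as coordinates on Q.

Besides the common edge of the two quadrilaterals, Q and Q_1 share the
generators mu = const whose parameter solves b mu^2 - 2 g mu - a = 0; the
discriminant of this equation is 4 T.  For T = 0 there is a single, double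
solution mu = g / b, and then Q and Q_1 have the same tangent plane at every
point of this generator ([quadric_point_transition],
[quadric_tangent_transition]).  In the same way Q and Q_2 touch along the
generator nu = bg / bb.

Let P be the point of Q with coordinates (g / b, bg / bb), where these two
generators of Q meet.  The point P lies on Q_1 as well, and the compatibility
conditions of the frame equations say precisely that its second coordinate on
Q_1 is the value of bg / bb at the shifted site, i.e. that P lies on the
generator along which Q_1 and Q_12 touch.  Thus each P lies on four contact
generators, which are the edges of a closed chain Q, Q_1, Q_12, Q_2, and the
four quadrics have the same tangent plane at P ([four_quadrics_touch]).

The point P and each of its four lattice neighbours lie on a common contact
generator through P, so the star of the net of all P lies in that plane
([star_envelope_point]).  Hence this single net, attached to the quadrilaterals
in any of the four ways for which P belongs to one of its four quadrics, is an
envelope; the four envelopes differ by unit shifts only.  None of their points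
is a vertex of the surface, as both coordinates of P on each of the four
quadrics are finite and nonzero. *)

(** * Neighbouring quadrics that share a double generator *)

Section QuadricOfFrame.
Variables (R : realFieldType) (n : nat).
Implicit Types (x y r s : 'rV[R]_n).

Definition quadric_point r r1 r2 r12 (mu nu : R) : 'rV[R]_n :=
  r12 + mu *: r1 + nu *: r2 + (mu * nu) *: r.

(** Spanned by the point and the directions of the two generators through it. *)
Definition quadric_tangent r r1 r2 r12 (mu nu : R) : {vspace 'rV[R]_n} :=
  <<[:: quadric_point r r1 r2 r12 mu nu; (r2 + mu *: r)%R; (r1 + nu *: r)%R]>>%VS.

(** The frame equations along one lattice edge.  Those of the other direction
have the same form after exchanging r1 and r2, so each statement about an edge
serves both directions. *)
Definition edge_transition (al u v a b : R) r r1 r2 r12 s s1 s2 s12 : Prop :=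
  [/\ s = al^-1 *: r1, s1 = - al *: r + u *: r1 + b *: r12,
      s2 = al^-1 *: r12 & s12 = a *: r1 - al *: r2 + v *: r12].

Lemma quadric_pointC r r1 r2 r12 mu nu :
  quadric_point r r2 r1 r12 nu mu = quadric_point r r1 r2 r12 mu nu.
Proof. by rewrite /quadric_point mulrC [r12 + _ + _]addrAC. Qed.

Lemma quadric_tangentC r r1 r2 r12 mu nu :
  quadric_tangent r r2 r1 r12 nu mu = quadric_tangent r r1 r2 r12 mu nu.
Proof.
rewrite /quadric_tangent quadric_pointC; apply: eq_span => x.
by rewrite !inE; congr (_ || _); rewrite orbC.
Qed.

(** By [uv] and [a_lam], lam is a double root of b x^2 - (u - v) x - a.  Expanded
in the frame of the first quadric, the point (lam, nu') of the second one has
coefficient k at r12 and - al at r2; hence [k_nu] is the condition that the two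
points (lam, nu) and (lam, nu') of the common generator coincide. *)
Section Transition.
Variables (al u v a b lam nu nu' : R) (r r1 r2 r12 s s1 s2 s12 : 'rV[R]_n).
Hypothesis tr : edge_transition al u v a b r r1 r2 r12 s s1 s2 s12.
Hypotheses (al_neq0 : al != 0) (uv : u - v = 2%:R * (b * lam)).
Hypothesis (a_lam : a = - b * lam ^+ 2).
Let k := (u + v) / 2%:R + nu' / al.
Hypothesis (k_nu : nu * k = - al).

Let k_neq0 : k != 0.
Proof. by apply: contraNneq al_neq0 => k0; rewrite -oppr_eq0 -k_nu k0 mulr0. Qed.

Let nu_neq0 : nu != 0.
Proof. by apply: contraNneq al_neq0 => n0; rewrite -oppr_eq0 -k_nu n0 mul0r. Qed.

Let uE : u = v + 2%:R * (b * lam).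
Proof. by rewrite -uv; ring. Qed.

Let nu'E : nu' = al * (k - v - b * lam).
Proof. by rewrite /k uE; field. Qed.

Lemma quadric_point_transition :
  quadric_point s s1 s2 s12 lam nu' = k *: quadric_point r r1 r2 r12 lam nu.
Proof.
have [-> -> -> ->] := tr; rewrite /quadric_point nu'E uE a_lam.
move: k k_neq0 k_nu => K K0 KN.
have -> : al = - (nu * K) by rewrite KN opprK.
by apply/rowP => c; rewrite !mxE; field; rewrite K0 nu_neq0.
Qed.

Let edge_dir : s2 + lam *: s =
  al^-1 *: (quadric_point r r1 r2 r12 lam nu - nu *: (r2 + lam *: r)).
Proof.
have [-> _ -> _] := tr; rewrite /quadric_point.
by apply/rowP => c; rewrite !mxE; field.
Qed.

Let across_dir : s1 + nu' *: s = (b * al) *: (s2 + lam *: s) + k *: (r1 + nu *: r).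
Proof.
have [-> -> -> _] := tr; rewrite nu'E uE.
move: k k_neq0 k_nu => K K0 KN.
have -> : al = - (nu * K) by rewrite KN opprK.
by apply/rowP => c; rewrite !mxE; field; rewrite K0 nu_neq0.
Qed.

(** Both tangent planes contain the common generator.  The transversal direction
s1 + nu' s of the second quadric differs from k (r1 + nu r) by a multiple of a
vector on that generator, which uses that the root lam is double. *)
Lemma quadric_tangent_transition :
  quadric_tangent s s1 s2 s12 lam nu' = quadric_tangent r r1 r2 r12 lam nu.
Proof.
have mem3 : forall p q t : 'rV[R]_n, [/\ p \in <<[:: p; q; t]>>%VS,
    q \in <<[:: p; q; t]>>%VS & t \in <<[:: p; q; t]>>%VS].
  by move=> p q t; split; apply: memv_span; rewrite !inE eqxx ?orbT.
rewrite /quadric_tangent quadric_point_transition.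
apply/eqP; rewrite eqEsubv; apply/andP; split; apply/span_subvP => x; rewrite !inE.
- set W := <<_>>%VS; have [p q t] := mem3 (quadric_point r r1 r2 r12 lam nu)
    (r2 + lam *: r) (r1 + nu *: r); rewrite -/W in p q t.
  have e : s2 + lam *: s \in W.
    by rewrite edge_dir; apply: memvZ; apply: memvB => //; apply: memvZ.
  case/or3P => /eqP -> //; first exact: memvZ.
  by rewrite across_dir; apply: memvD; apply: memvZ.
- set W := <<_>>%VS; have [p q t] := mem3 (k *: quadric_point r r1 r2 r12 lam nu)
    (s2 + lam *: s) (s1 + nu' *: s); rewrite -/W in p q t.
  have p' : quadric_point r r1 r2 r12 lam nu \in W.
    by rewrite -[quadric_point _ _ _ _ _ _](scalerK k_neq0); apply: memvZ.
  case/or3P => /eqP -> //.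
    have -> : r2 + lam *: r =
        nu^-1 *: (quadric_point r r1 r2 r12 lam nu - al *: (s2 + lam *: s)).
      rewrite edge_dir scalerA divff // scale1r subKr.
      by rewrite scalerA mulVf // scale1r.
    by apply: memvZ; apply: memvB => //; apply: memvZ.
  have -> : r1 + nu *: r =
      k^-1 *: (s1 + nu' *: s - (b * al) *: (s2 + lam *: s)).
    by rewrite across_dir addrAC subrr add0r scalerA mulVf // scale1r.
  by apply: memvZ; apply: memvB => //; apply: memvZ.
Qed.

End Transition.

Lemma free4_eq r r1 r2 r12 (x x1 x2 x12 y y1 y2 y12 : R) :
    free [:: r; r1; r2; r12] ->
    x *: r + x1 *: r1 + x2 *: r2 + x12 *: r12 =
    y *: r + y1 *: r1 + y2 *: r2 + y12 *: r12 ->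
  [/\ x = y, x1 = y1, x2 = y2 & x12 = y12].
Proof.
move=> /(@freeP _ _ 4 [tuple r; r1; r2; r12]) fr4 /eqP; rewrite -subr_eq0 => /eqP e.
have := fr4 (fun i => [:: x - y; x1 - y1; x2 - y2; x12 - y12]`_i).
rewrite !big_ord_recl big_ord0 /= addr0 => /(_ _) z.
have {}z : forall i : 'I_4, [:: x - y; x1 - y1; x2 - y2; x12 - y12]`_i = 0.
  by apply: z; rewrite -[RHS]e; apply/rowP => c; rewrite !mxE; ring.
split; apply/eqP; rewrite -subr_eq0; apply/eqP.
- exact: (z (@Ordinal 4 0 isT)).
- exact: (z (@Ordinal 4 1 isT)).
- exact: (z (@Ordinal 4 2 isT)).
- exact: (z (@Ordinal 4 3 isT)).
Qed.

Lemma quadric_point_inj r r1 r2 r12 mu nu mu' nu' (c : R) :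
    free [:: r; r1; r2; r12] ->
    quadric_point r r1 r2 r12 mu nu = c *: quadric_point r r1 r2 r12 mu' nu' ->
  mu = mu' /\ nu = nu'.
Proof.
move=> fr4 e.
have [|_ e1 e2 e12] := @free4_eq r r1 r2 r12 (mu * nu) mu nu 1
  (c * (mu' * nu')) (c * mu') (c * nu') c fr4.
  have -> : forall z z1 z2 z12 : R, z *: r + z1 *: r1 + z2 *: r2 + z12 *: r12 =
      z12 *: r12 + z1 *: r1 + z2 *: r2 + z *: r.
    by move=> *; apply/rowP => d; rewrite !mxE; ring.
  rewrite scale1r -/(quadric_point _ _ _ _ _ _) e.
  by apply/rowP => d; rewrite !mxE; ring.
by rewrite e1 e2 -e12 !mul1r.
Qed.

Lemma quadric_point_not_vertex r r1 r2 r12 mu nu x (c : R) :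
    free [:: r; r1; r2; r12] -> mu != 0 -> nu != 0 ->
    x \in [:: r; r1; r2; r12] ->
  quadric_point r r1 r2 r12 mu nu <> c *: x.
Proof.
move=> fr4 mu0 nu0 xin e.
have eq4 := @free4_eq r r1 r2 r12 (mu * nu) mu nu 1.
have pE : quadric_point r r1 r2 r12 mu nu =
    (mu * nu) *: r + mu *: r1 + nu *: r2 + 1 *: r12.
  by apply/rowP => d; rewrite !mxE; ring.
move: xin; rewrite !inE => /or4P[] /eqP xE; rewrite {}xE pE in e.
- have [|_ z _ _] := eq4 c 0 0 0 fr4; last by rewrite z eqxx in mu0.
  by rewrite e !scale0r !addr0.
- have [|_ _ z _] := eq4 0 c 0 0 fr4; last by rewrite z eqxx in nu0.
  by rewrite e !scale0r !addr0 add0r.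
- have [|_ z _ _] := eq4 0 0 c 0 fr4; last by rewrite z eqxx in mu0.
  by rewrite e !scale0r !addr0 !add0r.
- have [|_ z _ _] := eq4 0 0 0 c fr4; last by rewrite z eqxx in mu0.
  by rewrite e !scale0r !add0r.
Qed.

End QuadricOfFrame.

(** * Compatibility of the frame equations *)

(** Reduces the derivation of an equation from another one to an identity that
exhibits the factor c between the two. *)
Lemma eq_scaled_diff (R : comPzRingType) (c x y z w : R) :
  c * (x - y) = z - w -> x = y -> z = w.
Proof. by move=> e xy; apply/eqP; rewrite -subr_eq0 -e xy subrr mulr0. Qed.

Section Compatibility.
Variables (R : realFieldType) (n : nat).

(** The vectors p1 and p12 of the frame at the opposite corner are computed along
both paths around the quadrilateral, and their coefficients are compared. *)
Lemma frame_compatibility (al u v a b bal bu bv ba bb : R)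
    (al2 u2 v2 a2 b2 bal1 bu1 bv1 ba1 bb1 : R)
    (r r1 r2 r12 s s1 s2 s12 t t1 t2 t12 p p1 p2 p12 : 'rV[R]_n) :
    free [:: r; r1; r2; r12] -> bal != 0 -> bal1 != 0 ->
    edge_transition al u v a b r r1 r2 r12 s s1 s2 s12 ->
    edge_transition bal bu bv ba bb r r2 r1 r12 t t2 t1 t12 ->
    edge_transition al2 u2 v2 a2 b2 t t1 t2 t12 p p1 p2 p12 ->
    edge_transition bal1 bu1 bv1 ba1 bb1 s s2 s1 s12 p p2 p1 p12 ->
  [/\ a = - (bal1 * bal * b2), a * ba = al * bal - al2 * bal1,
      bal1 * u2 = a * bv + bal * v, bal * v2 = bal1 * u - a * bv1
    & al * bv1 = al2 * bu - ba * v2].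
Proof.
move=> fr4 bal0 bal10 [es es1 es2 es12] [et et2 et1 et12].
move=> [_ ep1 _ ep12] [_ _ ep1' ep12'].
have [|_ e1 e2 e12] := @free4_eq R n r r1 r2 r12
    0 (- bal * b2) (b2 * ba - al2 / bal) (u2 / bal + b2 * bv)
    0 (a / bal1) (- al / bal1) (v / bal1) fr4.
  transitivity p1; first rewrite ep1 et et1 et12; last rewrite ep1' es12;
    by apply/rowP => c; rewrite !mxE; ring.
have [|_ f1 f2 _] := @free4_eq R n r r1 r2 r12
    (al2 * bal) (- bal * v2) (v2 * ba - al2 * bu) (a2 / bal - al2 * bb + v2 * bv)
    (bal1 * al) (bv1 * a - bal1 * u) (- al * bv1)
    (ba1 / al - bal1 * b + bv1 * v) fr4.
  transitivity p12; first rewrite ep12 et1 et2 et12; last rewrite ep12' es1 es2 es12;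
    by apply/rowP => c; rewrite !mxE; ring.
have ea : a = - (bal1 * bal * b2) by apply: (eq_scaled_diff (c := - bal1)) e1; field.
split=> //.
- by apply: (eq_scaled_diff (c := - (bal * bal1))) e2; rewrite ea; field; rewrite ?bal0 ?bal10.
- by apply: (eq_scaled_diff (c := bal * bal1)) e12; rewrite ea; field; rewrite ?bal0 ?bal10.
- by apply: (eq_scaled_diff (c := -1)) f1; ring.
- by apply: (eq_scaled_diff (c := 1)) f2; ring.
Qed.

End Compatibility.

Section Scalars.
Variable R : realFieldType.

(** How g = (u - v) / 2 changes in the second direction.  The first relation
concerns the edge from Q to Q_2, the second one the opposite edge from Q_1 to
Q_12. *)
Lemma half_difference_relations (al u v a bal bu bv ba : R)
    (al2 u2 v2 bal1 bu1 bv1 : R) :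
    al2 != 0 -> bal1 != 0 ->
    al * bal1 = bal * al2 -> a * ba = al * bal - al2 * bal1 ->
    bal1 * u2 = a * bv + bal * v -> bal * v2 = bal1 * u - a * bv1 ->
    al2 * bu1 = ba * v + al * bv -> al * bv1 = al2 * bu - ba * v2 ->
  bal1 * ((u2 - v2) / 2%:R) + bal * ((u - v) / 2%:R) = a * ((bu + bv) / 2%:R) /\
  bal * ((u2 - v2) / 2%:R) + bal1 * ((u - v) / 2%:R) = a * ((bu1 + bv1) / 2%:R).
Proof.
move=> al20 bal10 albal aba eu2 ev2 ebu1 ebv1.
have z1 : a * ba - (al * bal - al2 * bal1) = 0 by rewrite aba subrr.
have z2 : bal * v2 - (bal1 * u - a * bv1) = 0 by rewrite ev2 subrr.
have z3 : al * bv1 - (al2 * bu - ba * v2) = 0 by rewrite ebv1 subrr.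
have z4 : al * bal1 - bal * al2 = 0 by rewrite albal subrr.
have z5 : bal1 * u2 - (a * bv + bal * v) = 0 by rewrite eu2 subrr.
have z6 : al2 * bu1 - (ba * v + al * bv) = 0 by rewrite ebu1 subrr.
(* a * bv1 is eliminated between the two relations for v2 and bv1, and a * ba
   from the result. *)
have ev2' : bal1 * v2 = bal * u - a * bu.
  apply: (mulfI al20); apply/eqP; rewrite -subr_eq0.
  rewrite (_ : _ - _ = v2 * (a * ba - (al * bal - al2 * bal1))
      + al * (bal * v2 - (bal1 * u - a * bv1))
      - a * (al * bv1 - (al2 * bu - ba * v2)) + u * (al * bal1 - bal * al2)); last by ring.
  by rewrite z1 z2 z3 z4 !mulr0 subr0 !addr0.
(* Likewise a * bv is eliminated between the relations for u2 and bu1. *)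
have eu2' : bal * u2 = bal1 * v + a * bu1.
  apply: (mulfI (mulf_neq0 bal10 al20)); apply/eqP; rewrite -subr_eq0.
  rewrite (_ : _ - _ = bal * al2 * (bal1 * u2 - (a * bv + bal * v))
      - bal1 * a * (al2 * bu1 - (ba * v + al * bv))
      - (a * bv + v * bal) * (al * bal1 - bal * al2)
      - v * bal1 * (a * ba - (al * bal - al2 * bal1))); last by ring.
  by rewrite z1 z4 z5 z6 !mulr0 !subr0.
split.
- apply: (eq_scaled_diff (c := 2%:R^-1) _ (_ : bal1 * u2 - bal1 * v2 =
    (a * bv + bal * v) - (bal * u - a * bu))); first by field.
  by rewrite eu2 ev2'.
- apply: (eq_scaled_diff (c := 2%:R^-1) _ (_ : bal * u2 - bal * v2 =
    (bal1 * v + a * bu1) - (bal1 * u - a * bv1))); first by field.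
  by rewrite eu2' ev2.
Qed.

(** Here g / b and g' / b' are the parameters of two successive contact generators.
As g / b = - a / g and b' is proportional to a, their product is a multiple of
g' / g, and the relation between g and g' that comes from compatibility becomes
the hypothesis [k_nu] needed to pass to the next quadric. *)
Lemma double_root_relation (a b g b' g' x y w : R) :
    b != 0 -> b' != 0 -> x != 0 -> y != 0 ->
    a * b + g ^+ 2 = 0 -> a = - (x * y * b') -> y * g' + x * g = a * w ->
  g / b * (w + g' / b' / x) = - x.
Proof.
move=> b0 b'0 x0 y0 T0 ea eg.
have a0 : a != 0 by rewrite ea oppr_eq0 !mulf_neq0.
have g0 : g != 0.
  apply: contraNneq (mulf_neq0 a0 b0) => g0.
  by move: T0; rewrite g0 expr0n addr0 => ->.
have -> : g / b = - (a / g).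
  by apply: (eq_scaled_diff (c := (g * b)^-1)) T0; field; rewrite ?b0 ?g0.
have -> : w = (y * g' + x * g) / a by rewrite eg; field.
by rewrite ea; field; rewrite ?g0 ?x0 ?y0 ?b'0.
Qed.

Lemma double_root (a b u v : R) : b != 0 -> a * b + ((u - v) / 2%:R) ^+ 2 = 0 ->
  u - v = 2%:R * (b * ((u - v) / 2%:R / b)) /\
  a = - b * ((u - v) / 2%:R / b) ^+ 2.
Proof.
move=> b0 T0; split; first by field.
by apply: (eq_scaled_diff (c := b^-1)) T0; field.
Qed.

End Scalars.

(** * Tangent planes as polar planes *)

Section Polar.
Variables (R : realFieldType) (A : 'M[R]_4).
Hypothesis A_sym : A^T = A.

Lemma polarC x y : polar A x y = polar A y x.
Proof.
have -> : polar A y x = (y *m A *m x^T)^T 0 0 by rewrite mxE.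
by rewrite !trmx_mul trmxK A_sym mulmxA.
Qed.

Lemma polarDr x y z : polar A x (y + z) = polar A x y + polar A x z.
Proof. by rewrite /polar linearD mulmxDr mxE. Qed.

Lemma polarZr c x y : polar A x (c *: y) = c * polar A x y.
Proof. by rewrite /polar linearZ -scalemxAr mxE. Qed.

Lemma polarZl c x y : polar A (c *: x) y = c * polar A x y.
Proof. by rewrite polarC polarZr polarC. Qed.

Lemma polar_span0 x (s : seq 'rV[R]_4) y :
  (forall z, z \in s -> polar A x z = 0) -> y \in <<s>>%VS -> polar A x y = 0.
Proof.
move=> s0 /(coord_span (X := in_tuple s)) ->.
elim/big_ind: _ => [|z z' z0 z'0|i _]; first by rewrite -(scale0r x) polarZr mul0r.
  by rewrite polarDr z0 z'0 addr0.
by rewrite polarZr s0 ?mulr0 // mem_nth.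
Qed.

(** If two points and a further point of their line lie on the quadric, so does
the whole line. *)
Lemma polar_chord x y :
  on_quadric A x -> on_quadric A y -> on_quadric A (x + y) -> polar A x y = 0.
Proof.
rewrite /on_quadric => x0 y0.
rewrite polarDr polarC polarDr x0 add0r [polar A (x + y) y]polarC polarDr y0 addr0.
rewrite [polar A y x]polarC => /eqP; rewrite -mulr2n mulrn_eq0 => /eqP //.
Qed.

(** Moving along a generator changes one parameter only, so the sum of the point
and a direction vector is again a point of the quadric; the direction vectors
themselves are the points of the generators at infinite parameter. *)
Lemma quadric_tangent_polar r r1 r2 r12 mu nu y :
    (forall x, on_quadric A x <-> exists s m t n : R,
      x = (s * t) *: r12 + (m * t) *: r1 + (s * n) *: r2 + (m * n) *: r) ->
    y \in quadric_tangent r r1 r2 r12 mu nu ->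
  polar A (quadric_point r r1 r2 r12 mu nu) y = 0.
Proof.
move=> onA; apply: polar_span0 => z.
have on_point mu' nu' : on_quadric A (quadric_point r r1 r2 r12 mu' nu').
  by apply/onA; exists 1, mu', 1, nu'; rewrite /quadric_point !mulr1 !mul1r scale1r.
rewrite !inE => /or3P[] /eqP ->; first exact: on_point.
- apply: polar_chord; first exact: on_point.
    by apply/onA; exists 1, mu, 0, 1; apply/rowP => c; rewrite !mxE; ring.
  have -> : quadric_point r r1 r2 r12 mu nu + (r2 + mu *: r) =
      quadric_point r r1 r2 r12 mu (nu + 1) by apply/rowP => c; rewrite !mxE; ring.
  exact: on_point.
- apply: polar_chord; first exact: on_point.
    by apply/onA; exists 0, 1, 1, nu; apply/rowP => c; rewrite !mxE; ring.
  have -> : quadric_point r r1 r2 r12 mu nu + (r1 + nu *: r) =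
      quadric_point r r1 r2 r12 (mu + 1) nu by apply/rowP => c; rewrite !mxE; ring.
  exact: on_point.
Qed.

End Polar.

Section SamePoint.
Variable R : fieldType.
Implicit Types x y z : 'rV[R]_4.

Lemma same_point_refl x : same_point x x.
Proof. by exists 1; rewrite ?oner_eq0 ?scale1r. Qed.

Lemma same_point_sym x y : same_point x y -> same_point y x.
Proof. by case=> c c0 ->; exists c^-1; rewrite ?invr_eq0 // scalerK. Qed.

Lemma same_point_trans y x z : same_point x y -> same_point y z -> same_point x z.
Proof.
by case=> c c0 -> [d d0 ->]; exists (c * d); rewrite ?mulf_neq0 // scalerA.
Qed.

End SamePoint.

(** The coefficient b measures how far three consecutive vertices of a
coordinate polygon are from being collinear: for b = 0 the vertex two steps
away, which is a multiple of s1, lies on the line through r and r1. *)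
Lemma edge_transition_collinear (R : realFieldType) (al u v a : R)
    (r r1 r2 r12 s s1 s2 s12 x y z : 'rV[R]_4) :
    edge_transition al u v a 0 r r1 r2 r12 s s1 s2 s12 ->
    same_point x r -> same_point y r1 -> same_point z s1 ->
  collinear [:: x; y; z].
Proof.
move=> [_ es1 _ _] [c _ ->] [d _ ->] [e _ ->].
apply: leq_trans (dim_span [:: r; r1]); apply/dimvS/span_subvP => w.
have rW : r \in <<[:: r; r1]>>%VS by rewrite memv_span // mem_head.
have r1W : r1 \in <<[:: r; r1]>>%VS by rewrite memv_span // !inE eqxx orbT.
rewrite !inE => /or3P[] /eqP ->; rewrite ?es1 ?scale0r ?addr0 memvZ //.
by rewrite memvD // memvZ.
Qed.

(** * The Lie quadrics of a Demoulin surface *)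

Definition lie_point (R : realFieldType) (F : frame R) i j (mu nu : R) :=
  quadric_point (fr F i j) (fr1 F i j) (fr2 F i j) (fr12 F i j) mu nu.

Definition lie_tangent (R : realFieldType) (F : frame R) i j (mu nu : R) :=
  quadric_tangent (fr F i j) (fr1 F i j) (fr2 F i j) (fr12 F i j) mu nu.

(** Parameters of the generators along which a quadric touches its successors in
the first and in the second direction. *)
Definition contact_mu (R : realFieldType) (F : frame R) i j := fg F i j / fb F i j.
Definition contact_nu (R : realFieldType) (F : frame R) i j := bg F i j / bb F i j.

Definition envelope_point (R : realFieldType) (F : frame R) i j :=
  lie_point F i j (contact_mu F i j) (contact_nu F i j).

Section Demoulin.
Variables (R : realFieldType) (S : lattice 'rV[R]_4).
Variables (Q : lattice 'M[R]_4) (F : frame R).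
Hypothesis hS : demoulin S Q F.

Lemma Lie_quadric_sym i j : (Q i j)^T = Q i j.
Proof. by have [[_ _ [/(_ i j)[]]]] := hS. Qed.

Lemma on_Lie_quadric i j x : on_quadric (Q i j) x <->
  exists s m t n : R,
    x = (s * t) *: fr12 F i j + (m * t) *: fr1 F i j
        + (s * n) *: fr2 F i j + (m * n) *: fr F i j.
Proof. by have [[_ _ _ [_ [_ [onQ _]]]]] := hS. Qed.

Lemma frame_same_point i j : same_point (fr F i j) (S i j).
Proof. by have [[_ _ _ [h _]]] := hS. Qed.

Lemma alpha_neq0 i j : alpha F i j != 0.
Proof. by have [[_ _ _ [_ [/(_ i j)[]]]]] := hS. Qed.

Lemma balpha_neq0 i j : balpha F i j != 0.
Proof. by have [[_ _ _ [_ [/(_ i j)[]]]]] := hS. Qed.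

Lemma alpha_balpha i j :
  alpha F i j * balpha F (i + 1) j = balpha F i j * alpha F i (j + 1).
Proof. by have [[_ _ _ [_ [/(_ i j)[]]]]] := hS. Qed.

Lemma transition1 i j :
  edge_transition (alpha F i j) (fu F i j) (fv F i j) (fa F i j) (fb F i j)
    (fr F i j) (fr1 F i j) (fr2 F i j) (fr12 F i j)
    (fr F (i + 1) j) (fr1 F (i + 1) j) (fr2 F (i + 1) j) (fr12 F (i + 1) j).
Proof. by have [[_ _ _ [_ [_ [_ /(_ i j)[]]]]]] := hS. Qed.

Lemma transition2 i j :
  edge_transition (balpha F i j) (bu F i j) (bv F i j) (ba F i j) (bb F i j)
    (fr F i j) (fr2 F i j) (fr1 F i j) (fr12 F i j)
    (fr F i (j + 1)) (fr2 F i (j + 1)) (fr1 F i (j + 1)) (fr12 F i (j + 1)).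
Proof.
have [[_ _ _ [_ [_ [_ /(_ i j)[_ [e e1 e2 e12]]]]]] _ _] := hS.
by split=> //; rewrite [LHS]e12 [_ *: _ - _]addrC scaleNr.
Qed.

Lemma same_point_fr1 i j : same_point (S (i + 1) j) (fr1 F i j).
Proof.
apply: same_point_trans (same_point_sym (frame_same_point _ _)) _.
have [-> _ _ _] := transition1 i j.
by exists (alpha F i j)^-1; rewrite ?invr_eq0 ?alpha_neq0.
Qed.

Lemma same_point_fr2 i j : same_point (S i (j + 1)) (fr2 F i j).
Proof.
apply: same_point_trans (same_point_sym (frame_same_point _ _)) _.
have [-> _ _ _] := transition2 i j.
by exists (balpha F i j)^-1; rewrite ?invr_eq0 ?balpha_neq0.
Qed.

Lemma same_point_fr12 i j : same_point (S (i + 1) (j + 1)) (fr12 F i j).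
Proof.
apply: same_point_trans (same_point_fr2 _ _) _.
have [_ _ -> _] := transition1 i j.
by exists (alpha F i j)^-1; rewrite ?invr_eq0 ?alpha_neq0.
Qed.

(** The vertices of a quadrilateral of the surface are multiples of the frame
vectors and span the whole space, as the quadrilateral is not planar. *)
Lemma frame_free i j : free [:: fr F i j; fr1 F i j; fr2 F i j; fr12 F i j].
Proof.
have [[_ [/(_ i j) ncop _ _] _ _ _] _ _] := hS.
rewrite /free eqn_leq dim_span /=; move: ncop; rewrite -ltnNge => /leq_trans.
apply; apply/dimvS/span_subvP => x; rewrite !inE.
case/or4P => /eqP ->; rewrite /sh12 /sh1 /sh2.
- by have [c _ ->] := same_point_sym (frame_same_point i j);
    rewrite memvZ // memv_span // !inE eqxx.
- by have [c _ ->] := same_point_fr1 i j; rewrite memvZ // memv_span // !inE eqxx ?orbT.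
- by have [c _ ->] := same_point_fr2 i j; rewrite memvZ // memv_span // !inE eqxx ?orbT.
- by have [c _ ->] := same_point_fr12 i j; rewrite memvZ // memv_span // !inE eqxx ?orbT.
Qed.

Lemma fb_neq0 i j : fb F i j != 0.
Proof.
have [[_ [_ /(_ i j) ncol _] _ _ _] _ _] := hS.
apply: contraNneq ncol => b0; have := transition1 i j; rewrite b0.
move=> /edge_transition_collinear; apply; last exact: same_point_fr1.
  exact: same_point_sym (frame_same_point i j).
exact: same_point_fr1.
Qed.

Lemma bb_neq0 i j : bb F i j != 0.
Proof.
have [[_ [_ _ /(_ i j) ncol] _ _ _] _ _] := hS.
apply: contraNneq ncol => b0; have := transition2 i j; rewrite b0.
move=> /edge_transition_collinear; apply; last exact: same_point_fr2.
  exact: same_point_sym (frame_same_point i j).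
exact: same_point_fr2.
Qed.

Lemma fT0 i j : fa F i j * fb F i j + fg F i j ^+ 2 = 0.
Proof. by have [_ h _] := hS; apply: h. Qed.

Lemma bT0 i j : ba F i j * bb F i j + bg F i j ^+ 2 = 0.
Proof. by have [_ _ h] := hS; apply: h. Qed.

Lemma compatibility1 i j :
  [/\ fa F i j = - (balpha F (i + 1) j * balpha F i j * fb F i (j + 1)),
      fa F i j * ba F i j =
        alpha F i j * balpha F i j - alpha F i (j + 1) * balpha F (i + 1) j,
      balpha F (i + 1) j * fu F i (j + 1) =
        fa F i j * bv F i j + balpha F i j * fv F i j,
      balpha F i j * fv F i (j + 1) =
        balpha F (i + 1) j * fu F i j - fa F i j * bv F (i + 1) j
    & alpha F i j * bv F (i + 1) j =
        alpha F i (j + 1) * bu F i j - ba F i j * fv F i (j + 1)].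
Proof.
exact: frame_compatibility (frame_free i j) (balpha_neq0 _ _) (balpha_neq0 _ _)
  (transition1 i j) (transition2 i j) (transition1 i (j + 1)) (transition2 (i + 1) j).
Qed.

Lemma compatibility2 i j :
  [/\ ba F i j = - (alpha F i (j + 1) * alpha F i j * bb F (i + 1) j),
      ba F i j * fa F i j =
        balpha F i j * alpha F i j - balpha F (i + 1) j * alpha F i (j + 1),
      alpha F i (j + 1) * bu F (i + 1) j =
        ba F i j * fv F i j + alpha F i j * bv F i j,
      alpha F i j * bv F (i + 1) j =
        alpha F i (j + 1) * bu F i j - ba F i j * fv F i (j + 1)
    & balpha F i j * fv F i (j + 1) =
        balpha F (i + 1) j * fu F i j - fa F i j * bv F (i + 1) j].
Proof.
have fr4 : free [:: fr F i j; fr2 F i j; fr1 F i j; fr12 F i j].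
  rewrite (perm_free (Y := [:: fr F i j; fr1 F i j; fr2 F i j; fr12 F i j])).
    exact: frame_free.
  by rewrite perm_cons (perm_catCA [:: _] [:: _] [:: _]).
exact: frame_compatibility fr4 (alpha_neq0 _ _) (alpha_neq0 _ _)
  (transition2 i j) (transition1 i j) (transition2 (i + 1) j) (transition1 i (j + 1)).
Qed.

(** The point where the two contact generators of Q meet has, on the next quadric
in the first direction, the value of [contact_nu] there as second coordinate. *)
Lemma contact_nu_relation i j :
  contact_nu F i j * ((fu F i j + fv F i j) / 2%:R
    + contact_nu F (i + 1) j / alpha F i j) = - alpha F i j.
Proof.
have [ea ea2 eu ev ebv] := compatibility2 i j.
have [_ _ eu1 _ _] := compatibility1 i j.
apply: (double_root_relation (y := alpha F i (j + 1))) (bT0 i j) _ _;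
  rewrite ?bb_neq0 ?alpha_neq0 //; last first.
  exact: (half_difference_relations
    (balpha_neq0 (i + 1) j) (alpha_neq0 i (j + 1)) (esym (alpha_balpha i j))
    ea2 eu ev eu1 ebv).1.
by rewrite ea [alpha _ _ _ * alpha _ _ _]mulrC.
Qed.

Lemma contact_mu_relation i j :
  contact_mu F i j * ((bu F i j + bv F i j) / 2%:R
    + contact_mu F i (j + 1) / balpha F i j) = - balpha F i j.
Proof.
have [ea ea2 eu ev ebv] := compatibility1 i j.
have [_ _ eu1 _ _] := compatibility2 i j.
apply: (double_root_relation (y := balpha F (i + 1) j)) (fT0 i j) _ _;
  rewrite ?fb_neq0 ?balpha_neq0 //; last first.
  exact: (half_difference_relations
    (alpha_neq0 i (j + 1)) (balpha_neq0 (i + 1) j) (alpha_balpha i j)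
    ea2 eu ev eu1 ebv).1.
by rewrite ea [balpha _ _ _ * balpha _ _ _]mulrC.
Qed.

(** The same on the opposite edge: the meeting point for Q, regarded as a point of
Q_1, has on Q_12 the first coordinate that it has on Q_2. *)
Lemma contact_mu_relation_shifted i j :
  contact_mu F i j * ((bu F (i + 1) j + bv F (i + 1) j) / 2%:R
    + contact_mu F i (j + 1) / balpha F (i + 1) j) = - balpha F (i + 1) j.
Proof.
have [ea ea2 eu ev ebv] := compatibility1 i j.
have [_ _ eu1 _ _] := compatibility2 i j.
apply: double_root_relation (fT0 i j) ea _;
  rewrite ?fb_neq0 ?balpha_neq0 //.
exact: (half_difference_relations
    (alpha_neq0 i (j + 1)) (balpha_neq0 (i + 1) j) (alpha_balpha i j)
    ea2 eu ev eu1 ebv).2.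
Qed.

Lemma Lie_quadrics_touch1 i j nu nu' :
    nu * ((fu F i j + fv F i j) / 2%:R + nu' / alpha F i j) = - alpha F i j ->
  same_point (lie_point F (i + 1) j (contact_mu F i j) nu')
             (lie_point F i j (contact_mu F i j) nu) /\
  lie_tangent F (i + 1) j (contact_mu F i j) nu' =
    lie_tangent F i j (contact_mu F i j) nu.
Proof.
move=> e; have [uv av] := double_root (fb_neq0 i j) (fT0 i j).
split; last exact: (quadric_tangent_transition (transition1 i j) (alpha_neq0 i j) uv av e).
eexists; last first.
  exact: (quadric_point_transition (transition1 i j) (alpha_neq0 i j) uv av e).
by apply: contraNneq (alpha_neq0 i j) => k0; rewrite -oppr_eq0 -e k0 mulr0.
Qed.

Lemma Lie_quadrics_touch2 i j mu mu' :
    mu * ((bu F i j + bv F i j) / 2%:R + mu' / balpha F i j) = - balpha F i j ->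
  same_point (lie_point F i (j + 1) mu' (contact_nu F i j))
             (lie_point F i j mu (contact_nu F i j)) /\
  lie_tangent F i (j + 1) mu' (contact_nu F i j) =
    lie_tangent F i j mu (contact_nu F i j).
Proof.
move=> e; have [uv av] := double_root (bb_neq0 i j) (bT0 i j).
rewrite /lie_point /lie_tangent -!(quadric_pointC _ _ (fr2 F _ _)).
rewrite -!(quadric_tangentC _ _ (fr2 F _ _)).
split; last exact: (quadric_tangent_transition (transition2 i j) (balpha_neq0 i j) uv av e).
eexists; last first.
  exact: (quadric_point_transition (transition2 i j) (balpha_neq0 i j) uv av e).
by apply: contraNneq (balpha_neq0 i j) => k0; rewrite -oppr_eq0 -e k0 mulr0.
Qed.

(** The quadric diagonally opposite is reached through the neighbour in the first
direction. *)
Lemma four_quadrics_touch (e f : bool) i j :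
  same_point (lie_point F (i + e%:Z) (j + f%:Z)
      (contact_mu F i (j + f%:Z)) (contact_nu F (i + e%:Z) j)) (envelope_point F i j) /\
  lie_tangent F (i + e%:Z) (j + f%:Z)
      (contact_mu F i (j + f%:Z)) (contact_nu F (i + e%:Z) j) =
    lie_tangent F i j (contact_mu F i j) (contact_nu F i j).
Proof.
have [P1 T1] := Lie_quadrics_touch1 (contact_nu_relation i j).
have [P2 T2] := Lie_quadrics_touch2 (contact_mu_relation i j).
have [P12 T12] := Lie_quadrics_touch2 (contact_mu_relation_shifted i j).
case: e f => [] [] /=; rewrite ?addr0 //; last by split=> //; apply: same_point_refl.
by split; [apply: same_point_trans P12 P1 | rewrite T12].
Qed.

(** * The four envelopes *)

Lemma contact_nu_neq0 i j : contact_nu F i j != 0.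
Proof.
apply: contraNneq (alpha_neq0 i j) => n0.
by rewrite -oppr_eq0 -contact_nu_relation n0 mul0r.
Qed.

Lemma contact_mu_neq0 i j : contact_mu F i j != 0.
Proof.
apply: contraNneq (balpha_neq0 i j) => n0.
by rewrite -oppr_eq0 -contact_mu_relation n0 mul0r.
Qed.

Lemma lie_point_tangent_mu i j mu mu' nu :
  lie_point F i j mu' nu \in lie_tangent F i j mu nu.
Proof.
have -> : lie_point F i j mu' nu =
    lie_point F i j mu nu + (mu' - mu) *: (fr1 F i j + nu *: fr F i j).
  by apply/rowP => c; rewrite !mxE; ring.
by rewrite memvD ?memvZ // memv_span // !inE eqxx ?orbT.
Qed.

Lemma lie_point_tangent_nu i j mu nu nu' :
  lie_point F i j mu nu' \in lie_tangent F i j mu nu.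
Proof.
rewrite /lie_point /lie_tangent -quadric_pointC -quadric_tangentC.
have -> : quadric_point (fr F i j) (fr2 F i j) (fr1 F i j) (fr12 F i j) nu' mu =
    quadric_point (fr F i j) (fr2 F i j) (fr1 F i j) (fr12 F i j) nu mu
    + (nu' - nu) *: (fr2 F i j + mu *: fr F i j).
  by apply/rowP => c; rewrite !mxE; ring.
by rewrite memvD ?memvZ // memv_span // !inE eqxx ?orbT.
Qed.

(** The neighbours of P in the positive directions lie on generators of Q_1 and
Q_2 through P, those in the negative directions on generators of Q through P;
all these generators lie in the common tangent plane. *)
Lemma star_envelope_point i j x : x \in star (envelope_point F) i j ->
  x \in lie_tangent F i j (contact_mu F i j) (contact_nu F i j).
Proof.
rewrite /star /sh1 /sh2 /sh1V /sh2V !inE; case/or4P => [||| /orP[]] /eqP ->.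
- exact: lie_point_tangent_mu.
- have [_] := four_quadrics_touch true false i j; rewrite /= !addr0 => <-.
  exact: lie_point_tangent_mu.
- have [_] := four_quadrics_touch false true i j; rewrite /= !addr0 => <-.
  exact: lie_point_tangent_nu.
- have [/same_point_sym[c _ ->] _] := four_quadrics_touch true false (i - 1) j.
  by rewrite /= !addr0 subrK memvZ // lie_point_tangent_mu.
- have [/same_point_sym[c _ ->] _] := four_quadrics_touch false true i (j - 1).
  by rewrite /= !addr0 subrK memvZ // lie_point_tangent_nu.
Qed.

Definition shifted_envelope (e f : bool) : lattice 'rV[R]_4 :=
  fun i j => envelope_point F (i - e%:Z) (j - f%:Z).

Lemma shifted_envelope_lie_point (e f : bool) i j :
  same_point (lie_point F i j (contact_mu F (i - e%:Z) j) (contact_nu F i (j - f%:Z)))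
    (shifted_envelope e f i j).
Proof.
by have [] := four_quadrics_touch e f (i - e%:Z) (j - f%:Z); rewrite !subrK.
Qed.

Lemma star_shifted_envelope (e f : bool) i j x : x \in star (shifted_envelope e f) i j ->
  x \in lie_tangent F i j (contact_mu F (i - e%:Z) j) (contact_nu F i (j - f%:Z)).
Proof.
have [_] := four_quadrics_touch e f (i - e%:Z) (j - f%:Z).
rewrite !subrK => -> xS; apply: star_envelope_point; move: xS.
rewrite /star /sh1 /sh2 /sh1V /sh2V /shifted_envelope.
by rewrite ![_ + 1 - _]addrAC ![_ - 1 - _]addrAC.
Qed.

Lemma shifted_envelope_not_vertex (e f : bool) i j x c :
  x \in [:: fr F i j; fr1 F i j; fr2 F i j; fr12 F i j] ->
  shifted_envelope e f i j != c *: x.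
Proof.
move=> xin; have [d d0 ->] := same_point_sym (shifted_envelope_lie_point e f i j).
apply/eqP => /(congr1 (fun y => d^-1 *: y)); rewrite scalerK // scalerA.
exact: quadric_point_not_vertex (frame_free i j) (contact_mu_neq0 _ _)
  (contact_nu_neq0 _ _) xin.
Qed.

Lemma shifted_envelope_envelope (e f : bool) : envelope Q (shifted_envelope e f).
Proof.
have tangent i j x : x \in star (shifted_envelope e f) i j ->
    in_tangent_plane (Q i j) (shifted_envelope e f i j) x.
  have [c _ ->] := same_point_sym (shifted_envelope_lie_point e f i j).
  move=> /star_shifted_envelope xT; rewrite /in_tangent_plane.
  rewrite polarZl ?Lie_quadric_sym // (quadric_tangent_polar _ _ xT) ?mulr0 //.
    exact: Lie_quadric_sym.
  exact: on_Lie_quadric.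
split=> //; last by move=> i j; apply: tangent; rewrite inE eqxx.
split=> i j.
  have := shifted_envelope_not_vertex e f 0 (mem_head (fr F i j) _).
  by rewrite scale0r; apply.
apply: (@leq_trans (\dim (lie_tangent F i j
    (contact_mu F (i - e%:Z) j) (contact_nu F i (j - f%:Z))))); last exact: dim_span.
exact/dimvS/span_subvP/star_shifted_envelope.
Qed.

Lemma shifted_envelope_distinct (e f : bool) : distinct_from_net S (shifted_envelope e f).
Proof.
move=> i j x xS /same_point_trans sx.
have frx y : y \in [:: fr F i j; fr1 F i j; fr2 F i j; fr12 F i j] -> same_point x y -> False.
  by move=> yin /sx[c _ /eqP]; apply/negP/shifted_envelope_not_vertex.
move: xS; rewrite !inE /sh12 /sh1 /sh2 => /or4P[] /eqP xE; move: frx; rewrite xE => frx.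
- by apply: frx (same_point_sym (frame_same_point i j)); rewrite !inE eqxx.
- by apply: frx (same_point_fr1 i j); rewrite !inE eqxx ?orbT.
- by apply: frx (same_point_fr2 i j); rewrite !inE eqxx ?orbT.
- by apply: frx (same_point_fr12 i j); rewrite !inE eqxx ?orbT.
Qed.

Lemma shifted_envelope_coincide (e f e' f' : bool) :
  coincide (shifted_envelope e f) (shifted_envelope e' f').
Proof.
have sub a b a' b' x : (exists i j, same_point x (shifted_envelope a b i j)) ->
    exists i j, same_point x (shifted_envelope a' b' i j).
  case=> i [j h]; exists (i - a%:Z + a'%:Z), (j - b%:Z + b'%:Z).
  by rewrite /shifted_envelope !addrK.
by move=> x; split; apply: sub.
Qed.

(** Both points lie on the same quadric, where coordinates are unique. *)
Lemma shifted_envelope_coordinates (e f e' f' : bool) :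
    same_parametrised_net (shifted_envelope e f) (shifted_envelope e' f') ->
  forall i j, contact_mu F (i - e%:Z) j = contact_mu F (i - e'%:Z) j /\
              contact_nu F i (j - f%:Z) = contact_nu F i (j - f'%:Z).
Proof.
move=> same i j.
have [c _ ] := same_point_trans (same_point_trans (shifted_envelope_lie_point e f i j)
  (same i j)) (same_point_sym (shifted_envelope_lie_point e' f' i j)).
exact: quadric_point_inj (frame_free i j).
Qed.

(** If two parametrisations that are attached differently in the first direction
agreed, [contact_mu] would be constant in that direction, and then consecutive
points of the net in this direction would have equal coordinates on the quadric
to which both belong. *)
Lemma shifted_envelope_differ (e f e' f' : bool) :
    ~ same_parametrised_net (envelope_point F) (sh1 (envelope_point F)) ->
    ~ same_parametrised_net (envelope_point F) (sh2 (envelope_point F)) ->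
    (e, f) <> (e', f') ->
  ~ same_parametrised_net (shifted_envelope e f) (shifted_envelope e' f').
Proof.
move=> nsame1 nsame2 ne /shifted_envelope_coordinates coord.
have [ee|nee] := eqVneq e e'; last first.
  apply: nsame1 => i j.
  have mu1 : contact_mu F i j = contact_mu F (i + 1) j.
    have := (coord (i + 1) j).1; case: (e) (e') nee => [] [] //= _;
      by rewrite subr0 addrK.
  have [/same_point_sym + _] := four_quadrics_touch true false i j.
  by rewrite /= !addr0 mu1.
have [ff|nff] := eqVneq f f'; first by apply: ne; rewrite ee ff.
apply: nsame2 => i j.
have nu1 : contact_nu F i j = contact_nu F i (j + 1).
  have := (coord i (j + 1)).2; case: (f) (f') nff => [] [] //= _;
    by rewrite subr0 addrK.
have [/same_point_sym + _] := four_quadrics_touch false true i j.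
by rewrite /= !addr0 nu1.
Qed.

End Demoulin.

(* The four envelopes are indexed by pairs of booleans.  Their parametrisations
   differ by unit shifts, so they are pairwise different parametrised nets
   unless the common net is constant along one of the lattice directions. *)
Theorem theorem5p6 (R : realFieldType) (S : lattice 'rV[R]_4)
    (Q : lattice 'M[R]_4) (F : frame R) (hS : demoulin S Q F) :
  exists Omega : bool -> bool -> lattice 'rV[R]_4,
    [/\ forall e f, envelope Q (Omega e f) /\ distinct_from_net S (Omega e f),
        forall e f e' f', coincide (Omega e f) (Omega e' f'),
        forall (e f : bool) (i j : int),
          same_point (Omega e f i j)
            (Omega false false (i - (nat_of_bool e)%:Z) (j - (nat_of_bool f)%:Z))
      & ~ same_parametrised_net (Omega false false) (sh1 (Omega false false)) ->
        ~ same_parametrised_net (Omega false false) (sh2 (Omega false false)) ->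
        forall e f e' f', (e, f) <> (e', f') ->
          ~ same_parametrised_net (Omega e f) (Omega e' f')].
Proof.
have base i j : shifted_envelope F false false i j = envelope_point F i j.
  by rewrite /shifted_envelope !subr0.
exists (shifted_envelope F); split.
- by move=> e f; split; [apply: shifted_envelope_envelope hS _ _
                       | apply: shifted_envelope_distinct hS _ _].
- exact: shifted_envelope_coincide.
- by move=> e f i j; rewrite base; apply: same_point_refl.
- move=> n1 n2 e f e' f'; apply: (shifted_envelope_differ hS).
    by move=> same; apply: n1 => i j; rewrite /sh1 !base; apply: same.
  by move=> same; apply: n2 => i j; rewrite /sh2 !base; apply: same.
Qed.
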